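(* Let $S=\{o_1,\dots,o_n\}$ be a finite set of $n\ge 2$ OIE instances, let $\alpha<\beta$ be real numbers, and let $(i_1,\dots,i_n)$ and $(j_1,\dots,j_n)$ be two index tuples of length $n$. Put $r=\oplus|_\alpha^\beta(o_{i_1},\dots,o_{i_n})$ and $r'=\oplus|_\alpha^\beta(o_{j_1},\dots,o_{j_n})$. Then there exists a permutation matrix $M$ such that $r$ and $r'$ are permutationally equivalent via $M$.
   Context: Times are real numbers; a ''2-tuple'' is a pair $(x,y)$ of reals with $x<y$ (starting and ending timestamp). For a nonempty finite tuple of 2-tuples $T=((x_1,y_1),\dots,(x_m,y_m))$ put $\mathrm{bound}(T)=(\min_i x_i,\max_i y_i)$. An OIE (Optional Intervals Event) instance is a 4-tuple $o=(\mathcal C_o,\mathcal F_o,\mathcal I_o,\mathcal A_o)$ where $\mathcal C_o$ is a finite (possibly empty) tuple of OIE instances, $\mathcal F_o$ is a set of nonempty finite tuples of 2-tuples, $\mathcal I_o=\{\mathrm{bound}(T):T\in\mathcal F_o\}$, and $\mathcal A_o$ is a set of (labels of) atomic events. The void instance is $o_{\mathrm{void}}=((),\emptyset,\emptyset,\emptyset)$; every other instance has $\mathcal F_o,\mathcal I_o,\mathcal A_o$ nonempty. Two instances are equal iff all four components are equal. An index tuple of length $n$ is a tuple in which each of $1,\dots,n$ occurs exactly once. A permutation matrix $M$ acts on $n$-tuples (viewed as row vectors) on the right by reordering the entries, $T\mapsto T\cdot M$. For $S=\{o_1,\dots,o_n\}$ and an index tuple $\sigma=(i_1,\dots,i_n)$,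 let $N(S,\sigma)=\{(t_1,\dots,t_n): t_k\in\mathcal I_{o_{i_k}}\text{ for all }k\}$. External constraints determine an infeasible subset $\mathrm{Inf}(S,\sigma)\subseteq N(S,\sigma)$; this is given data, subject only to the standing axiom: whenever $\sigma\cdot M=\tau$ for index tuples $\sigma,\tau$ of length $n>1$ and a permutation matrix $M$, the map $T\mapsto T\cdot M$ is a bijection from $\mathrm{Inf}(S,\sigma)$ onto $\mathrm{Inf}(S,\tau)$. Put $\mathrm{Feas}(S,\sigma)=N(S,\sigma)\setminus\mathrm{Inf}(S,\sigma)$. Domain filter: for a nonempty set $X$ of $n$-tuples of 2-tuples and reals $\alpha<\beta$, let $X'=\{T\in X: x\ge\alpha\text{ and }y\le\beta\text{ for every entry }(x,y)\text{ of }T\}$. Then $\mathrm{Dom}_\alpha^\beta(X)=X'$ if for every $k\in\{1,\dots,n\}$ some $T\in X'$ has $k$-th entry with first item $\alpha$ and some $T\in X'$ has $k$-th entry with second item $\beta$; otherwise $\mathrm{Dom}_\alpha^\beta(X)=\emptyset$. Complete Sequence Addition $\oplus|_\alpha^\beta(o_{i_1},\dots,o_{i_n})$ ($n\ge2$, $\sigma=(i_1,\dots,i_n)$): the result is $o_{\mathrm{void}}$ if $\bigcap_{k}\mathcal A_{o_{i_k}}\ne\emptyset$, or some $o_{i_k}=o_{\mathrm{void}}$, or $\mathrm{Feas}(S,\sigma)=\emptyset$, or $\mathrm{Dom}_\alpha^\beta(\mathrm{Feas}(S,\sigma))=\emptyset$. Otherwise the result is $(\mathcal C,\mathcal F,\mathcal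 I,\mathcal A)$ with $\mathcal C=(o_{i_1},\dots,o_{i_n})$, $\mathcal F=\mathrm{Dom}_\alpha^\beta(\mathrm{Feas}(S,\sigma))$, $\mathcal I=\{\mathrm{bound}(T):T\in\mathcal F\}$, $\mathcal A=\bigcup_k\mathcal A_{o_{i_k}}$. Permutational equivalence: two non-void instances $o,o'$ are permutationally equivalent via a permutation matrix $M$ if $\mathcal C_o\cdot M=\mathcal C_{o'}$, $T\mapsto T\cdot M$ is a bijection from $\mathcal F_o$ onto $\mathcal F_{o'}$, $\mathcal I_o=\mathcal I_{o'}$ and $\mathcal A_o=\mathcal A_{o'}$. By convention $o_{\mathrm{void}}$ is permutationally equivalent to itself via any permutation matrix, and to no non-void instance. *)

(* Defs.v *)
From mathcomp Require Import all_boot all_order all_fingroup all_algebra.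
From mathcomp Require Import all_classical all_reals.

Set Implicit Arguments.
Unset Strict Implicit.
Unset Printing Implicit Defensive.

Import Order.TTheory GRing.Theory Num.Theory.
Local Open Scope classical_set_scope.
Local Open Scope ring_scope.

(* The row vector [T] times the permutation matrix [M]; the entries of [T] need
   not live in a ring.  The default of [odflt] is never used when [M] is a
   permutation matrix, see [perm_mulE]. *)
Definition perm_mul (R : realType) (X : Type) (n : nat)
    (T : n.-tuple X) (M : 'M[R]_n) : n.-tuple X :=
  [tuple tnth T (odflt j [pick i | M i j == 1]) | j < n].

Lemma perm_mulE (R : realType) (n : nat) (T : n.-tuple R) (M : 'M[R]_n) :
  is_perm_mx M ->
  \row_j tnth (perm_mul T M) j = (\row_j tnth T j) *m M.
Proof.
case/is_perm_mxP=> s ->; apply/rowP=> j.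
rewrite !mxE tnth_mktuple (bigD1 (s^-1%g j)) //= big1 => [|i ne_ij].
  rewrite !mxE permKV eqxx mulr1 addr0; case: pickP => [i|/(_ (s^-1%g j))] /=.
    by rewrite !mxE pnatr_eq1 eqb1 => /eqP <-; rewrite permK.
  by rewrite !mxE permKV !eqxx.
rewrite !mxE; case: eqP => [sij|_]; last by rewrite mulr0.
by rewrite -sij permK eqxx in ne_ij.
Qed.

(* Raw 4-tuples (C, F, I, A); the instances are those satisfying [is_oie]. *)
Inductive oie (R : realType) (L : Type) : Type :=
  Oie of seq (oie R L) & set (seq (R * R)) & set (R * R) & set L.

Section Components.
Variables (R : realType) (L : Type).
Implicit Type o : oie R L.

Definition comps o := let: Oie C _ _ _ := o in C.
Definition feas_tuples o := let: Oie _ F _ _ := o in F.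
Definition intervals o := let: Oie _ _ Iv _ := o in Iv.
Definition atoms o := let: Oie _ _ _ A := o in A.

Definition oie_void : oie R L := Oie [::] set0 set0 set0.

End Components.

Arguments oie_void {R L}.

(* Only meant for nonempty [T]: min and max are folded from the head of [T]. *)
Definition bound (R : realType) (T : seq (R * R)) : R * R :=
  let p := head (0, 0) T in
  (\big[Num.min/p.1]_(q <- T) q.1, \big[Num.max/p.2]_(q <- T) q.2).

(* The set of intervals is nonempty as the image of the nonempty set [F]. *)
Inductive is_oie (R : realType) (L : Type) : oie R L -> Prop :=
| IsVoid : is_oie oie_void
| IsNonvoid (C : seq (oie R L)) (F : set (seq (R * R))) (A : set L) of
    (forall k c, onth C k = Some c -> is_oie c) &
    (forall T, F T -> T <> [::] /\ (forall p, p \in T -> p.1 < p.2)) &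
    F !=set0 & A !=set0 :
    is_oie (Oie C F [set bound T | T in F] A).

Definition index_tuple (n : nat) (s : n.-tuple 'I_n) : Prop :=
  forall i : 'I_n, count_mem i s = 1%N.

Section SequenceAddition.
Variables (R : realType) (L : Type).

(* A set {o_1, ..., o_n} of n instances, given by its enumeration. *)
Definition oie_set (n : nat) (S : 'I_n -> oie R L) : Prop :=
  injective S /\ forall i, is_oie (S i).

Definition all_tuples (n : nat) (S : 'I_n -> oie R L) (s : n.-tuple 'I_n) :
    set (n.-tuple (R * R)) :=
  [set T | forall k, intervals (S (tnth s k)) (tnth T k)].

Definition infeasibility : Type :=
  forall n : nat, ('I_n -> oie R L) -> n.-tuple 'I_n -> set (n.-tuple (R * R)).

Definition infeasibility_axiom (Inf : infeasibility) : Prop :=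
  forall (n : nat) (S : 'I_n -> oie R L), oie_set S ->
    (forall s, index_tuple s -> Inf n S s `<=` all_tuples S s) /\
    (forall (s t : n.-tuple 'I_n) (M : 'M[R]_n),
      (1 < n)%N -> index_tuple s -> index_tuple t -> is_perm_mx M ->
      perm_mul s M = t ->
      set_bij (Inf n S s) (Inf n S t) (fun T => perm_mul T M)).

Definition feasible (Inf : infeasibility) (n : nat) (S : 'I_n -> oie R L)
    (s : n.-tuple 'I_n) : set (n.-tuple (R * R)) :=
  all_tuples S s `\` Inf n S s.

Definition within (n : nat) (a b : R) (X : set (n.-tuple (R * R))) :
    set (n.-tuple (R * R)) :=
  [set T | X T /\ forall k, a <= (tnth T k).1 /\ (tnth T k).2 <= b].

Definition domain_filter (n : nat) (a b : R) (X : set (n.-tuple (R * R))) :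
    set (n.-tuple (R * R)) :=
  if `[< forall k, (exists2 T, within a b X T & (tnth T k).1 = a) /\
                   (exists2 T, within a b X T & (tnth T k).2 = b) >]
  then within a b X else set0.

Definition sequence_addition (Inf : infeasibility) (a b : R) (n : nat)
    (S : 'I_n -> oie R L) (s : n.-tuple 'I_n) : oie R L :=
  let D := domain_filter a b (feasible Inf S s) in
  let F := [set tval T | T in D] in
  if `[< \bigcap_k atoms (S (tnth s k)) !=set0 \/
         (exists k, S (tnth s k) = oie_void) \/
         feasible Inf S s = set0 \/ D = set0 >]
  then oie_void
  else Oie [seq S i | i <- s] F [set bound T | T in F]
           (\bigcup_k atoms (S (tnth s k))).

(* An n x n matrix only acts on tuples of length n, so the components and all
   feasible tuples of both instances are required to have length n. *)
Definition perm_equiv_via (n : nat) (M : 'M[R]_n) (o o' : oie R L) : Prop :=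
  is_perm_mx M /\
  ((o = oie_void /\ o' = oie_void) \/
   [/\ o <> oie_void /\ o' <> oie_void,
       exists C C' : n.-tuple (oie R L),
         [/\ comps o = C, comps o' = C' & perm_mul C M = C'],
       exists F F' : set (n.-tuple (R * R)),
         [/\ feas_tuples o = [set tval T | T in F],
             feas_tuples o' = [set tval T | T in F'] &
             set_bij F F' (fun T => perm_mul T M)],
       intervals o = intervals o' &
       atoms o = atoms o']).

End SequenceAddition.

(* Main.v *)
From mathcomp Require Import all_boot all_order all_fingroup all_algebra.
From mathcomp Require Import all_classical all_reals.
Require Import Defs.

(** Both additions are taken over the same set of instances, so the index
    tuples differ by a permutation of positions, say tau = sigma . M.  Acting
    by M on tuples of intervals is a bijection that merely renames positions,
    and every condition in the definition of the sequence addition treats all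
    positions alike.  The only ingredient that might not, the infeasible set, is
    made compatible by the standing axiom.  Precisely, each set attached to sigma
    is the preimage under the action of the corresponding set attached to tau:
    first the tuples of intervals and the feasible ones
    ([all_tuples_perm_mul], [feasible_perm_mul]), hence also the filtered ones
    ([domain_filter_perm_mul]).  As the action is bijective, emptiness agrees on
    both sides, so either both additions are void or none is, and in the latter
    case the action is the required bijection of feasible tuples.  The intervals
    agree since the bound of a nonempty tuple does not depend on the order of
    its entries ([bound_perm_eq]), and the atoms since a union does not depend
    on the order of its terms. *)

Set Implicit Arguments.
Unset Strict Implicit.
Unset Printing Implicit Defensive.

Import Order.TTheory GRing.Theory Num.Theory.
Local Open Scope classical_set_scope.
Local Open Scope ring_scope.

(** * Bounds of reordered tuples *)

Lemma big_swap_idx (T I : Type) (op : SemiGroup.com_law T) (x y : T)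
    (r : seq I) (F : I -> T) :
  op x (\big[op/y]_(i <- r) F i) = op y (\big[op/x]_(i <- r) F i).
Proof.
elim: r => [|i r IH]; first by rewrite !big_nil SemiGroup.opC.
by rewrite !big_cons ![op _ (op (F i) _)]SemiGroup.Theory.mulmCA IH.
Qed.

(** A starting value that is one of the terms is absorbed by idempotence, so
    which term is chosen as starting value does not matter. *)
Lemma big_idem_change_idx (T : Type) (I : eqType) (op : SemiGroup.com_law T)
    (r : seq I) (F : I -> T) (i j : I) :
  idempotent_op op -> i \in r -> j \in r ->
  \big[op/F i]_(k <- r) F k = \big[op/F j]_(k <- r) F k.
Proof.
move=> opxx ri rj.
have absorb x k : k \in r ->
    op (F k) (\big[op/x]_(l <- r) F l) = \big[op/x]_(l <- r) F l.
  by move=> rk; rewrite (big_rem_AC op x _ _ rk) SemiGroup.opA /= opxx.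
by rewrite -(absorb _ j rj) big_swap_idx absorb.
Qed.

(** The bound folds min and max starting from the head, which changes when the
    entries are permuted; reordering the fold alone is therefore not enough. *)
Lemma bound_perm_eq (R : realType) (s t : seq (R * R)) :
  s != [::] -> perm_eq s t -> bound s = bound t.
Proof.
case: s => // p s _ st.
have pt : p \in t by rewrite -(perm_mem st) mem_head.
case: t => [//|q t] in st pt *.
rewrite /bound /= !(perm_big _ st) /=.
congr pair; apply: big_idem_change_idx => //.
- exact: minxx.
- exact: mem_head.
- exact: maxxx.
- exact: mem_head.
Qed.

(** * The action of a permutation matrix on tuples *)

Section Action.
Variables (R : realType) (n : nat) (p : 'S_n).
Local Notation M := (perm_mx p : 'M[R]_n).

Lemma tnth_perm_mul (X : Type) (T : n.-tuple X) (k : 'I_n) :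
  tnth (perm_mul T M) k = tnth T ((p^-1)%g k).
Proof.
rewrite tnth_mktuple; congr (tnth T _).
case: pickP => [i|/(_ ((p^-1)%g k))] /=.
  by rewrite !mxE pnatr_eq1 eqb1 => /eqP <-; rewrite permK.
by rewrite !mxE permKV !eqxx.
Qed.

Lemma tnth_perm_mul_perm (X : Type) (T : n.-tuple X) (k : 'I_n) :
  tnth (perm_mul T M) (p k) = tnth T k.
Proof. by rewrite tnth_perm_mul permK. Qed.

Lemma perm_mul_inj (X : Type) : injective (fun T : n.-tuple X => perm_mul T M).
Proof.
move=> T U /= eTU; apply: eq_from_tnth => k.
by rewrite -[LHS]tnth_perm_mul_perm eTU tnth_perm_mul_perm.
Qed.

Lemma perm_mul_surj (X : Type) (U : n.-tuple X) : exists T, perm_mul T M = U.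
Proof.
exists [tuple tnth U (p k) | k < n]; apply: eq_from_tnth => k.
by rewrite tnth_perm_mul tnth_mktuple permKV.
Qed.

Lemma perm_mul_perm_eq (X : eqType) (T : n.-tuple X) : perm_eq (perm_mul T M) T.
Proof.
apply/tuple_permP; exists (p^-1)%g; congr val.
by apply: eq_from_tnth => k; rewrite tnth_perm_mul tnth_mktuple.
Qed.

Lemma perm_mul_map (X Y : Type) (f : X -> Y) (T : n.-tuple X) :
  perm_mul (map_tuple f T) M = map_tuple f (perm_mul T M).
Proof.
apply: eq_from_tnth => k.
by rewrite tnth_perm_mul tnth_map [RHS]tnth_map tnth_perm_mul.
Qed.

Lemma forall_perm_mul (X : Type) (T : n.-tuple X) (P : X -> Prop) :
  (forall k, P (tnth T k)) <-> (forall k, P (tnth (perm_mul T M) k)).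
Proof.
split=> PT k; first by rewrite tnth_perm_mul; apply: PT.
by rewrite -tnth_perm_mul_perm; apply: PT.
Qed.

Lemma exists_perm_mul (X : Type) (T : n.-tuple X) (P : X -> Prop) :
  (exists k, P (tnth (perm_mul T M) k)) = (exists k, P (tnth T k)).
Proof.
apply/propext; split=> [[k]|[k PT]].
  by rewrite tnth_perm_mul => PT; exists ((p^-1)%g k).
by exists (p k); rewrite tnth_perm_mul_perm.
Qed.

Lemma bigcap_perm_mul (X Y : Type) (T : n.-tuple X) (F : X -> set Y) :
  \bigcap_k F (tnth (perm_mul T M) k) = \bigcap_k F (tnth T k).
Proof.
apply/seteqP; split=> y Fy k _; last by rewrite tnth_perm_mul; apply: Fy.
by rewrite -tnth_perm_mul_perm; apply: Fy.
Qed.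

Lemma bigcup_perm_mul (X Y : Type) (T : n.-tuple X) (F : X -> set Y) :
  \bigcup_k F (tnth (perm_mul T M) k) = \bigcup_k F (tnth T k).
Proof.
apply/seteqP; split=> y [k _].
  by rewrite tnth_perm_mul => Fy; exists ((p^-1)%g k).
by rewrite -tnth_perm_mul_perm => Fy; exists (p k).
Qed.

Lemma preimage_perm_mul_eq0 (X : Type) (Y : set (n.-tuple X)) :
  (fun T => perm_mul T M) @^-1` Y = set0 <-> Y = set0.
Proof.
split=> [Y0|->]; last exact: preimage_set0.
rewrite -subset0 => U; have [T <-] := perm_mul_surj U => YT.
by have : ((fun T => perm_mul T M) @^-1` Y) T by []; rewrite Y0.
Qed.

Lemma set_bij_preimage_perm_mul (X : Type) (Y : set (n.-tuple X)) :
  set_bij ((fun T => perm_mul T M) @^-1` Y) Y (fun T => perm_mul T M).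
Proof.
split=> // [T U _ _|U]; first exact: perm_mul_inj.
by have [T <-] := perm_mul_surj U => YT; exists T.
Qed.

(** For a restriction of an injective map, being a bijection from A onto B
    determines A from B; this turns the axiom on infeasible sets into the same
    preimage form as the other compatibilities. *)
Lemma preimage_set_bij_perm_mul (X : Type) (A B : set (n.-tuple X)) :
  set_bij A B (fun T => perm_mul T M) -> A = (fun T => perm_mul T M) @^-1` B.
Proof.
move=> [AB _ BA]; apply/seteqP; split=> [|T /BA[U AU /perm_mul_inj <-//]].
exact: AB.
Qed.

End Action.

Lemma index_tuple_perm_mul (R : realType) (n : nat) (s t : n.-tuple 'I_n) :
  index_tuple s -> index_tuple t ->
  exists p : 'S_n, perm_mul s (perm_mx p : 'M[R]_n) = t.
Proof.
move=> hs ht.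
have /tuple_permP[p tE] : perm_eq t s.
  by apply/allP => k _ /=; rewrite hs ht.
(* Row k of the matrix of p has its 1 in column p k, so the entries of s are
   sent along p; the inverse fetches them instead. *)
exists (p^-1)%g; apply: eq_from_tnth => k.
by rewrite tnth_perm_mul invgK (val_inj tE) tnth_mktuple.
Qed.

(** * The filtered feasible tuples of reordered instances *)

Section Filter.
Variables (R : realType) (n : nat) (p : 'S_n) (a b : R).
Local Notation M := (perm_mx p : 'M[R]_n).
Local Notation act := (fun T : n.-tuple (R * R) => perm_mul T M).

Lemma within_perm_mul (Y : set (n.-tuple (R * R))) :
  within a b (act @^-1` Y) = act @^-1` within a b Y.
Proof.
have inE T := forall_perm_mul R p T (fun q => a <= q.1 /\ q.2 <= b).
apply/seteqP; split=> T [YT abT]; split=> //; first exact: (inE T).1 abT.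
exact: (inE T).2 abT.
Qed.

(** The endpoint conditions are required at every position, so moving the
    tuples by p turns the condition at k into the one at p k. *)
Lemma domain_filter_perm_mul (Y : set (n.-tuple (R * R))) :
  domain_filter a b (act @^-1` Y) = act @^-1` domain_filter a b Y.
Proof.
rewrite /domain_filter within_perm_mul.
have exE (P : R * R -> Prop) (k : 'I_n) :
    (exists2 T, (act @^-1` within a b Y) T & P (tnth T k)) <->
    (exists2 T, within a b Y T & P (tnth T (p k))).
  split=> [[T YT PT]|[U]].
    by exists (act T); rewrite // tnth_perm_mul_perm.
  have [T <-] := perm_mul_surj R p U.
  by rewrite tnth_perm_mul_perm; exists T.
set c1 := (X in `[< X >]).
set c2 := (X in _ = _ @^-1` (if `[< X >] then _ else _)).
have -> : c1 = c2.
  apply/propext; split=> h k.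
    have [h1 h2] := h ((p^-1)%g k).
    move/(exE (fun q => q.1 = a)): h1; move/(exE (fun q => q.2 = b)): h2.
    by rewrite permKV.
  have [h1 h2] := h (p k).
  by split; [apply/(exE (fun q => q.1 = a))|apply/(exE (fun q => q.2 = b))].
by case: ifP => _; rewrite ?preimage_set0.
Qed.

End Filter.

Section Feasible.
Variables (R : realType) (L : Type) (n : nat) (S : 'I_n -> oie R L).
Variables (p : 'S_n) (s : n.-tuple 'I_n).
Local Notation M := (perm_mx p : 'M[R]_n).
Local Notation act := (fun T : n.-tuple (R * R) => perm_mul T M).

Lemma all_tuples_perm_mul :
  all_tuples S s = act @^-1` all_tuples S (perm_mul s M).
Proof.
apply/seteqP; split=> T hT k; first by rewrite !tnth_perm_mul; apply: hT.
by have := hT (p k); rewrite !tnth_perm_mul_perm.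
Qed.

Lemma feasible_perm_mul (Inf : infeasibility R L) :
  infeasibility_axiom Inf -> (1 < n)%N -> oie_set S ->
  index_tuple s -> index_tuple (perm_mul s M) ->
  feasible Inf S s = act @^-1` feasible Inf S (perm_mul s M).
Proof.
move=> hInf n_gt1 /hInf[_ bijInf] hs ht.
have /preimage_set_bij_perm_mul InfE :=
  bijInf s _ M n_gt1 hs ht (perm_mx_is_perm _ _) erefl.
by rewrite /feasible InfE all_tuples_perm_mul.
Qed.

End Feasible.

Lemma bound_image_perm_mul (R : realType) (n : nat) (p : 'S_n)
    (Y : set (n.-tuple (R * R))) : (0 < n)%N ->
  [set bound T | T in
     [set tval T | T in (fun T => perm_mul T (perm_mx p : 'M[R]_n)) @^-1` Y]] =
  [set bound T | T in [set tval T | T in Y]].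
Proof.
move=> n_gt0.
have boundM (T : n.-tuple (R * R)) :
    bound (perm_mul T (perm_mx p : 'M[R]_n)) = bound T.
  apply: bound_perm_eq; last exact: perm_mul_perm_eq.
  by rewrite -size_eq0 size_tuple -lt0n.
apply/seteqP; split=> _ [_ [T YT <-] <-].
  exists (tval (perm_mul T (perm_mx p : 'M[R]_n))); last exact: boundM.
  by exists (perm_mul T (perm_mx p : 'M[R]_n)).
have [U UT] := perm_mul_surj R p T; exists U; last by rewrite -UT boundM.
by exists U; rewrite //= UT.
Qed.

Theorem mainTheorem2 (R : realType) (L : Type)
  (Inf : infeasibility R L) (hInf : infeasibility_axiom Inf)
  (n : nat) (hn : (2 <= n)%N)
  (S : 'I_n -> oie R L) (hS : oie_set S)
  (alpha beta : R) (hab : alpha < beta)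
  (i j : n.-tuple 'I_n) (hi : index_tuple i) (hj : index_tuple j) :
  exists M : 'M[R]_n,
    perm_equiv_via M (sequence_addition Inf alpha beta S i)
                     (sequence_addition Inf alpha beta S j).
Proof.
have [p jE] := index_tuple_perm_mul R hi hj; subst j.
exists (perm_mx p); split; first exact: perm_mx_is_perm.
have n_gt0 : (0 < n)%N := ltnW hn.
rewrite /sequence_addition (bigcap_perm_mul R p i (fun k => atoms (S k))).
rewrite (bigcup_perm_mul R p i (fun k => atoms (S k))).
rewrite (feasible_perm_mul (p := p) hInf) // domain_filter_perm_mul.
rewrite bound_image_perm_mul //.
rewrite !(propext (preimage_perm_mul_eq0 R p _)).
rewrite (exists_perm_mul R p i (fun k => S k = oie_void)).
(* A 4-tuple built by the addition has n > 0 components, the void instance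
   none. *)
have nonvoid (t : n.-tuple 'I_n) F Iv A :
    Oie [seq S k | k <- t] F Iv A <> oie_void.
  move=> /(congr1 (fun o => size (comps o))) /=.
  by rewrite size_map size_tuple => n0; rewrite n0 in n_gt0.
set act := (fun T : n.-tuple (R * R) => perm_mul T (perm_mx p : 'M[R]_n)).
case: ifP => _; first by left.
right; split=> //.
- exists (map_tuple S i), (map_tuple S (perm_mul i (perm_mx p : 'M[R]_n))).
  by split=> //; apply: perm_mul_map.
- exists (act @^-1` domain_filter alpha beta
                      (feasible Inf S (perm_mul i (perm_mx p : 'M[R]_n)))).
  exists (domain_filter alpha beta
            (feasible Inf S (perm_mul i (perm_mx p : 'M[R]_n)))).
  by split=> //; apply: set_bij_preimage_perm_mul.
Qed.
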